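(* Let $q>1$, and let $(V,E,\mu)$ be a weighted graph with vertex weight $\sigma$ as in the context. The following are equivalent: (i) the inequality $\partial_tu-\Delta_\sigma u\ge u^q$ on $(0,\infty)\times V$ admits a nontrivial (i.e. not identically zero) nonnegative global classical supersolution; (ii) the equation $\partial_tu-\Delta_\sigma u=u^q$ on $(0,\infty)\times V$ admits a positive global classical solution; (iii) for some $o\in V$ and $a>0$, the Cauchy problem $\partial_tu-\Delta_\sigma u=u^q$ ($t>0$, $x\in V$), $u(0,\cdot)=a\mathbf 1_{\{o\}}$, admits a positive global classical solution. Equivalently, condition (i) may be replaced by the existence of a positive global classical supersolution (one that is $>0$ everywhere on $(0,\infty)\times V$). More precisely, if $U$ is a supersolution as in (i), if $s>0$ and $o\in V$ satisfy $U(s,o)>0$, and if $0<a<U(s,o)$, then the Cauchy problem with $u_0=a\mathbf 1_{\{o\}}$ has a positive global classical solution $u$ satisfying $$0<u(t,x)\le U(s+t,x),\qquad t>0,\ x\in V.$$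
   Context: Let $(V,E)$ be an infinite, connected, locally finite graph with at most one edge between two distinct vertices and no loops. Let $\mu:V\times V\to[0,\infty)$ be symmetric with $\mu_{xy}>0$ if $x\sim y$ and $\mu_{xy}=0$ otherwise; put $\mu(x)=\sum_{y\sim x}\mu_{xy}$. Fix $\sigma:V\to(0,\infty)$ and set $\nu(x)=\sigma(x)\mu(x)$. The operator is $$\Delta_\sigma f(x)=\frac1{\nu(x)}\sum_{y\sim x}\mu_{xy}(f(y)-f(x)).$$ Standing assumption of the paper: the graph carries an edge-length function $\rho:E\to(0,\infty)$ (symmetric) that is $\nu$-adapted, i.e. $\sum_{y\sim x}\mu_{xy}\rho(x,y)^2\le\nu(x)$ for all $x$, and whose path metric $d_\rho(x,y)=\inf\sum_i\rho(x_{i-1},x_i)$ (infimum over paths from $x$ to $y$) is proper, i.e. all closed balls of $d_\rho$ are finite. A nonnegative global classical supersolution is a function $u:(0,\infty)\times V\to[0,\infty)$ with $u(\cdot,x)\in C^1((0,\infty))$ for every $x\in V$ satisfying $\partial_tu-\Delta_\sigma u\ge u^q$ pointwise. A positive global classical solution on $(0,\infty)\times V$ is a function $u:(0,\infty)\times V\to(0,\infty)$ with $u(\cdot,x)\in C^1((0,\infty))$ for every $x$ satisfying the equation pointwise. Neither notion includes a value or trace at $t=0$. A positive global classical solution of the Cauchy problem with datum $u_0:V\to[0,\infty)$ is a function $u:[0,\infty)\times V\to[0,\infty)$ with $u(\cdot,x)\in C([0,\infty))\cap C^1((0,\infty))$ for every $x\in V$, satisfying the equation pointwise for $t>0$, $u(0,\cdot)=u_0$,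 and $u(t,x)>0$ for all $t>0$, $x\in V$. *)

(* Defs.v *)
From HB Require Import structures.
From mathcomp Require Import all_boot all_order all_algebra.
From mathcomp Require Import all_classical all_reals all_analysis.

Set Implicit Arguments.
Unset Strict Implicit.
Unset Printing Implicit Defensive.

Import Order.TTheory GRing.Theory Num.Theory.
Import numFieldNormedType.Exports.

Local Open Scope classical_set_scope.
Local Open Scope ring_scope.

(* A boolean adjacency relation loses no generality, since the libraries used
   here are classical. *)
Record weightedGraph (R : realType) (V : choiceType) := WeightedGraph {
  adj : rel V;
  mu : V -> V -> R;
  adj_symmetric : symmetric adj;
  adj_irreflexive : irreflexive adj;
  vertices_infinite : infinite_set [set: V];
  locally_finite : forall x, finite_set [set y | adj x y];
  adj_connected : forall x y, exists2 p, path adj x p & last x p = y;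
  mu_symmetric : forall x y, mu x y = mu y x;
  mu_gt0 : forall x y, adj x y -> 0 < mu x y;
  mu_eq0 : forall x y, ~~ adj x y -> mu x y = 0
}.

Section Graph.
Variables (R : realType) (V : choiceType) (G : weightedGraph R V).

Definition neighbors (x : V) : set V := [set y | adj G x y].

Definition degree (x : V) : R := \sum_(y \in neighbors x) mu G x y.

Section Metric.
(* Edge lengths are given by a function on pairs of vertices, of which only the
   values on pairs of adjacent vertices are used. *)
Variable rho : V -> V -> R.

Definition edge_length :=
  forall x y, adj G x y -> 0 < rho x y /\ rho x y = rho y x.

Definition path_length (x : V) (p : seq V) : R :=
  \sum_(e <- zip (x :: p) p) rho e.1 e.2.

Definition path_metric (x y : V) : R :=
  inf [set path_length x p | p in [set p | path (adj G) x p /\ last x p = y]].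

Definition proper_path_metric :=
  forall x r, finite_set [set y | path_metric x y <= r].

End Metric.

Variable sigma : V -> R.

Definition nu (x : V) : R := sigma x * degree x.

Definition adapted (rho : V -> V -> R) :=
  forall x, \sum_(y \in neighbors x) mu G x y * rho x y ^+ 2 <= nu x.

Definition laplacian (f : V -> R) (x : V) : R :=
  (nu x)^-1 * \sum_(y \in neighbors x) mu G x y * (f y - f x).

(* Functions on (0,oo) x V or [0,oo) x V are represented by functions of type
   R -> V -> R. The predicates below do not depend on the values at the
   remaining times: derivatives are only taken at t > 0. *)

Definition C1_pos (f : R -> R) :=
  forall t : R, 0 < t -> derivable f t 1 /\ {for t, continuous (derive1 f)}.

Definition dt (u : R -> V -> R) (t : R) (x : V) : R := derive1 (fun s => u s x) t.

Variable q : R.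

Definition nonneg_supersolution (u : R -> V -> R) :=
  [/\ forall (t : R) (x : V), 0 < t -> 0 <= u t x,
      forall x, C1_pos (fun t => u t x)
    & forall (t : R) (x : V), 0 < t -> dt u t x - laplacian (u t) x >= u t x `^ q].

Definition nontrivial (u : R -> V -> R) := exists (t : R) (x : V), 0 < t /\ u t x != 0.

Definition positive (u : R -> V -> R) := forall (t : R) (x : V), 0 < t -> 0 < u t x.

Definition solves_eq (u : R -> V -> R) :=
  forall (t : R) (x : V), 0 < t -> dt u t x - laplacian (u t) x = u t x `^ q.

Definition positive_solution (u : R -> V -> R) :=
  [/\ positive u, forall x, C1_pos (fun t => u t x) & solves_eq u].

Definition positive_cauchy_solution (u0 : V -> R) (u : R -> V -> R) :=
  [/\ forall (t : R) (x : V), 0 <= t -> 0 <= u t x,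
      forall x, {within `[0, +oo[, continuous (fun t => u t x)} /\
                C1_pos (fun t => u t x),
      solves_eq u,
      forall x, u 0 x = u0 x
    & positive u].

End Graph.

(* Main.v *)
Require Import Defs.
From HB Require Import structures.
From mathcomp Require Import all_boot all_order all_algebra.
From mathcomp Require Import all_classical all_reals all_analysis.
From mathcomp Require Import finmap ring lra.

Set Implicit Arguments.
Unset Strict Implicit.
Unset Printing Implicit Defensive.

Import Order.TTheory GRing.Theory Num.Theory.
Import numFieldNormedType.Exports.

Local Open Scope classical_set_scope.
Local Open Scope ring_scope.

(** Split the equation at a vertex x into gain and loss:
    u' + k u = gain u, where k = degree x / nu x and
    gain u = (1/nu x) sum_y mu_xy u(y) + u(x)^q.
    With initial datum u0 it is equivalent to the Duhamel equation
    u(t) = e^(-kt) (u0 + int_0^t e^(kr) gain(u(r)) dr),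
    whose right-hand side is a monotone function of u on nonnegative
    functions, since all coefficients of the gain are nonnegative. Hence the
    Picard iterates, started from 0 on the whole infinite graph, increase. If U
    is a supersolution with u0 <= U(s, .), then the translate W(t) = U(s + t)
    satisfies W' + k W >= gain W, so that comparison of linear scalar equations,
    one vertex at a time, keeps every iterate below W
    ([picard_continuous_bounded]). The gain at a vertex involves a finite sum,
    so the pointwise limit u of the iterates solves the Duhamel equation by
    dominated convergence with dominating function gain W ([duhamel_cvg],
    [picard_lim_duhamel]). The integral equation then makes u continuous, hence
    the integrand continuous, hence u continuously differentiable for t > 0.

    Positivity: if u(t, x) = 0 for some t > 0, then t is a minimum of
    u(., x), so u' vanishes there, the equation forces gain u = 0, and every
    neighbour of x is a zero of u(t, .) as well. By connectedness
    u(t, .) = 0, which contradicts u(t, o) >= e^(-kt) u0(o) at a vertex o with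
    u0(o) > 0.

    This is [cauchy_solution_below_supersolution]. Applied to the datum
    a 1_o with 0 < a < U(s, o), it gives the quantitative assertion, from which
    the equivalences follow by comparing definitions. *)

(** * Scalar linear equations and Duhamel's formula *)

Section Calculus.
Variable R : realType.
Implicit Types (k c t : R) (f g h y w : R -> R).

Local Notation leb := (@lebesgue_measure R).

(** Convergence through [`^ q] needs nonnegative values: a negative base has
    power 1, so that the power function is discontinuous at 0 from the left. *)
Lemma cvg_powR (T : Type) (F : set_system T) (FF : Filter F) (f : T -> R)
    (l q : R) : 0 < q -> (forall z, 0 <= f z) -> 0 <= l ->
  f z @[z --> F] --> l -> f z `^ q @[z --> F] --> l `^ q.
Proof.
move=> q0 f0; rewrite le_eqVlt => /predU1P[<-|l0] fl; last first.
  suff : {for l, continuous (fun a => a `^ q)} by exact: cvg_comp fl.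
  apply: differentiable_continuous.
  by apply/derivable1_diffP; apply: derivable_powR; rewrite in_itv/= l0.
(* At the limit 0, f z < e ^ (1/q) ensures f z ^ q < e. *)
rewrite powR0 ?gt_eqF//; apply/cvgr0Pnorm_lt => e e0.
have r0 : 0 < e `^ q^-1 by rewrite powR_gt0.
move/cvgr0Pnorm_lt : fl => /(_ _ r0); apply: filterS => z.
rewrite !ger0_norm ?powR_ge0// => fz.
rewrite -[ltRHS]powRr1 ?ltW// -(mulVf (lt0r_neq0 q0)) powRrM.
by rewrite gt0_ltr_powR// ?nnegrE ?powR_ge0.
Qed.

(** Functions of a time t >= 0 are extended to the whole line by their value at
    0, through [clamp]: continuity on [0, +oo[ becomes plain continuity. *)
Definition clamp t := Order.max t 0.

Lemma clamp_ge0 t : 0 <= clamp t. Proof. by rewrite le_max lexx orbT. Qed.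

Lemma clamp_id t : 0 <= t -> clamp t = t. Proof. by move=> /max_idPl. Qed.

Lemma clampK t : clamp (clamp t) = clamp t.
Proof. by rewrite clamp_id// clamp_ge0. Qed.

Lemma near_clamp t : 0 < t -> \near t, clamp t = t.
Proof.
by move=> /lt_nbhsr; apply: filterS => z z0; rewrite clamp_id// ltW.
Qed.

Lemma continuous_clamp : continuous clamp.
Proof.
move=> t; apply: (@continuous_max R R id (cst 0)); first exact: cvg_id.
exact: cvg_cst.
Qed.

Lemma continuous_expM k : continuous (fun r : R => expR (k * r)).
Proof.
move=> r; apply: (@continuous_comp _ _ _ ( *%R k) expR).
  by apply: mulrl_continuous.
exact: continuous_expR.
Qed.

Lemma is_derive_expM k f df t : is_derive t 1 f df ->
  is_derive t 1 (fun r => expR (k * r) * f r) (expR (k * t) * (df + k * f t)).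
Proof.
move=> fE; have -> : (fun r => expR (k * r) * f r) = (expR \o ( *%R k)) * f.
  by apply/funext.
by apply: is_derive_eq; rewrite /GRing.scale /= !mulr1; ring.
Qed.

(** The integrating factor e^(kt) turns the difference w - y into a
    nondecreasing function, starting from a nonnegative value. *)
Lemma le_linear_ode k y w (dy dw : R -> R) :
  continuous y -> continuous w ->
  (forall t, 0 < t -> is_derive t 1 y (dy t)) ->
  (forall t, 0 < t -> is_derive t 1 w (dw t)) ->
  (forall t, 0 < t -> dy t + k * y t <= dw t + k * w t) ->
  y 0 <= w 0 -> forall t, 0 <= t -> y t <= w t.
Proof.
move=> cy cw yE wE yw yw0 t t0.
pose z t := expR (k * t) * (w - y) t.
have zE (r : R) : 0 < r ->
    is_derive r 1 z (expR (k * r) * ((dw r - dy r) + k * (w - y) r)).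
  by move=> r0; apply: is_derive_expM; apply: is_deriveB; [exact: wE|exact: yE].
have zP : z 0 <= z t.
  apply: (@ger0_derive1_ndecry _ z 0) => //.
  - by move=> r; rewrite in_itv/= andbT => /zE[].
  - move=> r; rewrite in_itv/= andbT => r0.
    rewrite derive1E; have [_ ->] := zE _ r0.
    rewrite mulr_ge0 ?expR_ge0// (_ : (w - y) r = w r - y r)//.
    by have := yw _ r0; lra.
  - apply: continuous_subspaceT => r; apply: cvgM; first exact: continuous_expM.
    by apply: cvgB; [exact: cw|exact: cy].
have : 0 <= z t.
  apply: le_trans zP; rewrite /z mulr0 expR0 mul1r.
  by rewrite (_ : (w - y) 0 = w 0 - y 0)// subr_ge0.
by rewrite pmulr_rge0 ?expR_gt0// (_ : (w - y) t = w t - y t)// subr_ge0.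
Qed.

(** The solution of y' + k y = g, y(0) = c, extended by c to negative times. *)
Definition duhamel k c g t :=
  expR (- k * clamp t) *
  (c + \int[leb]_(r in `[0, clamp t]) (expR (k * r) * g r)).

Definition duhamel_integrable k g :=
  forall b, leb.-integrable `[0, b] (EFin \o (fun r => expR (k * r) * g r)).

Lemma continuous_duhamel_integrable k g :
  continuous g -> duhamel_integrable k g.
Proof.
move=> cg b; apply: continuous_compact_integrable; first exact: segment_compact.
apply: continuous_subspaceT => r; apply: cvgM; last exact: cg.
exact: continuous_expM.
Qed.

Lemma duhamel0 k c g : duhamel k c g 0 = c.
Proof.
by rewrite /duhamel clamp_id// set_itv1 Rintegral_set1 mulr0 expR0 mul1r addr0.
Qed.

(** The source g is only integrable: this is how the limit of the iterates, at
    first a mere pointwise limit, becomes continuous. *)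
Lemma continuous_duhamel k c g :
  duhamel_integrable k g -> continuous (duhamel k c g).
Proof.
move=> ig t; apply: cvgM.
  apply: (@continuous_comp _ _ _ clamp (fun r => expR (- k * r))).
    exact: continuous_clamp.
  exact: continuous_expM.
apply: cvgD; first exact: cvg_cst.
have b0 : 0 <= clamp t + 1 by rewrite addr_ge0// clamp_ge0.
have /subspace_continuousP := parameterized_integral_continuous b0 (ig _).
move=> /(_ (clamp t)); rewrite /= in_itv/= clamp_ge0 lerDl ler01 => /(_ isT) cI.
apply: cvg_comp cI.
(* clamp sends a neighbourhood of t into [0, clamp t + 1] *)
move=> A; rewrite /within/= => nA.
have near_lt : \forall r \near t, clamp r < clamp t + 1.
  have lt1 : clamp t < clamp t + 1 by rewrite ltrDl.
  exact: (@continuous_clamp t [set r | r < clamp t + 1] (lt_nbhsl lt1)).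
have near_A : \forall r \near t,
    `[0, clamp t + 1]%classic (clamp r) -> A (clamp r).
  exact: (@continuous_clamp t [set r | `[0, clamp t + 1]%classic r -> A r] nA).
apply: filterS2 near_lt near_A => r rt; apply.
by rewrite /= in_itv/= clamp_ge0 ltW.
Qed.

Lemma is_derive_duhamel k c g t :
  duhamel_integrable k g -> 0 < t -> {for t, continuous g} ->
  is_derive t 1 (duhamel k c g) (g t - k * duhamel k c g t).
Proof.
move=> ig t0 cg.
pose I b := \int[leb]_(r in `[0, b]) (expR (k * r) * g r).
have [dI IE] : derivable I t 1 /\ derive1 I t = expR (k * t) * g t.
  apply: (@continuous_FTC1_closed _ _ 0 t (t + 1)) => //.
    by rewrite ltrDl.
  by apply: cvgM => //; exact: continuous_expM.
have ? : is_derive t 1 I (expR (k * t) * g t).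
  by rewrite -IE derive1E; exact/derivableP.
apply: (@near_eq_is_derive _ _ _ (fun r => expR (- k * r) * (cst c + I) r)).
  by near=> r; rewrite /duhamel (near (near_clamp t0) r).
have cI : is_derive t 1 (cst c + I) (0 + expR (k * t) * g t).
  exact: is_deriveD.
apply: (is_derive_eq (is_derive_expM (- k) cI)).
rewrite /duhamel clamp_id ?ltW// -/(I t) add0r (_ : (cst c + I) t = c + I t)//.
rewrite mulrDr mulrA mulNr expRN mulVf ?gt_eqF ?expR_gt0// mul1r; ring.
Unshelve. all: by end_near. Qed.

Lemma duhamel_clamp k c g t : duhamel k c g (clamp t) = duhamel k c g t.
Proof. by rewrite /duhamel clampK. Qed.

(** Comparison for the Duhamel formula, with any sub- or supersolution of the
    scalar equation and not only with another solution. *)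
Section Comparison.
Variables (k c : R) (g : R -> R).
Hypothesis cg : continuous g.

Let ig : duhamel_integrable k g := continuous_duhamel_integrable k cg.

Lemma duhamel_le_super w (dw : R -> R) :
  continuous w -> (forall t, 0 < t -> is_derive t 1 w (dw t)) ->
  (forall t, 0 < t -> g t <= dw t + k * w t) -> c <= w 0 ->
  forall t, duhamel k c g t <= w (clamp t).
Proof.
move=> cw wE gw cw0 t; rewrite -duhamel_clamp.
apply: (@le_linear_ode k _ _ (fun r => g r - k * duhamel k c g r) dw
  (continuous_duhamel (c := c) ig) cw
  (fun r r0 => is_derive_duhamel c ig r0 (@cg r)) wE) => //.
- by move=> r r0; rewrite subrK; exact: gw.
- by rewrite duhamel0.
- exact: clamp_ge0.
Qed.

Lemma duhamel_ge_sub y (dy : R -> R) :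
  continuous y -> (forall t, 0 < t -> is_derive t 1 y (dy t)) ->
  (forall t, 0 < t -> dy t + k * y t <= g t) -> y 0 <= c ->
  forall t, y (clamp t) <= duhamel k c g t.
Proof.
move=> cy yE gy cy0 t; rewrite -duhamel_clamp.
apply: (@le_linear_ode k _ _ dy (fun r => g r - k * duhamel k c g r)
  cy (continuous_duhamel (c := c) ig) yE
  (fun r r0 => is_derive_duhamel c ig r0 (@cg r))) => //.
- by move=> r r0; rewrite subrK; exact: gy.
- by rewrite duhamel0.
- exact: clamp_ge0.
Qed.

Lemma duhamel_ge_initial t : (forall r, 0 < r -> 0 <= g r) ->
  expR (- k * clamp t) * c <= duhamel k c g t.
Proof.
move=> g0.
have yE (r : R) : is_derive r 1 (fun r => expR (- k * r) * cst c r)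
    (expR (- k * r) * (0 + - k * c)) by exact: is_derive_expM.
apply: (@duhamel_ge_sub _ _ _ (fun r _ => yE r)).
- by move=> r; apply: cvgM; [exact: continuous_expM|exact: cvg_cst].
- move=> r r0; rewrite [leLHS](_ : _ = 0) ?g0//.
  by rewrite /cst; ring.
- by rewrite mulr0 expR0 mul1r.
Qed.

End Comparison.

Lemma le_duhamel k c g h t : continuous g -> continuous h ->
  (forall r, 0 < r -> g r <= h r) -> duhamel k c g t <= duhamel k c h t.
Proof.
move=> cg ch gh; have ih := continuous_duhamel_integrable k ch.
rewrite -[leRHS]duhamel_clamp.
apply: (@duhamel_le_super k c g cg _ (fun r => h r - k * duhamel k c h r)
  (continuous_duhamel (c := c) ih)
  (fun r r0 => is_derive_duhamel c ih r0 (@ch r))).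
- by move=> r r0; rewrite subrK; exact: gh.
- by rewrite duhamel0.
Qed.

(** Dominated convergence. The limit source g is only a pointwise limit, so its
    integrability is part of the conclusion. *)
Lemma duhamel_cvg k c (g_ : nat -> R -> R) g h :
  (forall n, continuous (g_ n)) -> continuous h ->
  (forall n r, 0 <= r -> 0 <= g_ n r <= h r) ->
  (forall r, 0 <= r -> g_ n r @[n --> \oo] --> g r) ->
  duhamel_integrable k g /\
  forall t, duhamel k c (g_ n) t @[n --> \oo] --> duhamel k c g t.
Proof.
move=> cg ch gh g_g.
have key b : leb.-integrable `[0, b] (EFin \o (fun r => expR (k * r) * g r)) /\
    \int[leb]_(r in `[0, b]) (expR (k * r) * g_ n r) @[n --> \oo] -->
    \int[leb]_(r in `[0, b]) (expR (k * r) * g r).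
  have mg n := measurable_int _ (continuous_duhamel_integrable k (cg n) b).
  have gE r : `[0, b]%classic r ->
      (expR (k * r) * g_ n r)%:E @[n --> \oo] --> (expR (k * r) * g r)%:E.
    rewrite /= in_itv/= => /andP[r0 _].
    by apply: cvg_EFin; [exact: nearW|apply: cvgM; [exact: cvg_cst|exact: g_g]].
  have [||||||ig _ cgg] := @dominated_convergence _ _ _ leb `[0, b]%classic _
      (fun n => EFin \o (fun r => expR (k * r) * g_ n r))
      (EFin \o (fun r => expR (k * r) * g r))
      (EFin \o (fun r => expR (k * r) * h r)).
  - exact: measurable_itv.
  - exact: mg.
  - exact: measurable_realfun.emeasurable_fun_cvg mg gE.
  - exact: aeW.
  - exact: continuous_duhamel_integrable.
  - apply: aeW => r n; rewrite /= in_itv/= => /andP[r0 _].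
    have /andP[g0 gh0] := gh n _ r0.
    by rewrite lee_fin ger0_norm ?mulr_ge0 ?expR_ge0// ler_wpM2l ?expR_ge0.
  split=> //; apply: fine_cvg; rewrite fineK; first exact: cgg.
  exact: integrable_fin_num.
split=> [b|t]; first by have [] := key b.
apply: cvgM; first exact: cvg_cst.
by apply: cvgD; [exact: cvg_cst|have [] := key (clamp t)].
Qed.

End Calculus.

(** * Gain and loss at a vertex *)

Section GraphOperators.
Variables (R : realType) (V : choiceType) (G : weightedGraph R V).
Variables (sigma : V -> R) (q : R).
Hypotheses (sigma_gt0 : forall x, 0 < sigma x) (q_gt0 : 0 < q).
Implicit Types (f g : V -> R) (x y : V).

Definition loss x : R := (nu G sigma x)^-1 * degree G x.

Definition gain f x : R :=
  (nu G sigma x)^-1 * (\sum_(y \in neighbors G x) mu G x y * f y) + f x `^ q.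

Lemma neighbors_sumE x (F : V -> R) :
  \sum_(y \in neighbors G x) F y = \sum_(y <- fset_set (neighbors G x)) F y.
Proof. by rewrite fsbig_finite//; exact: locally_finite. Qed.

Lemma mu_ge0 x y : 0 <= mu G x y.
Proof.
by have [/mu_gt0/ltW//|/mu_eq0->] := boolP (adj G x y).
Qed.

Lemma le_neighbors_sum x f g : (forall y, f y <= g y) ->
  \sum_(y \in neighbors G x) mu G x y * f y <=
  \sum_(y \in neighbors G x) mu G x y * g y.
Proof.
move=> fg; rewrite !neighbors_sumE ler_sum// => y _.
by rewrite ler_wpM2l ?mu_ge0.
Qed.

Lemma le_term_neighbors_sum x y f : (forall z, 0 <= f z) -> adj G x y ->
  mu G x y * f y <= \sum_(z \in neighbors G x) mu G x z * f z.
Proof.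
move=> f0 xy; rewrite neighbors_sumE (big_fsetD1 y)/=; last first.
  by rewrite in_fset_set; [exact/mem_set|exact: locally_finite].
by rewrite lerDl sumr_ge0// => z _; rewrite mulr_ge0// mu_ge0.
Qed.

Lemma nu_ge0 x : 0 <= nu G sigma x.
Proof.
rewrite mulr_ge0 ?(ltW (sigma_gt0 x))// /degree neighbors_sumE.
by rewrite sumr_ge0// => y _; exact: mu_ge0.
Qed.

Lemma adj_nu_gt0 x y : adj G x y -> 0 < nu G sigma x.
Proof.
move=> xy; rewrite mulr_gt0//.
have := @le_term_neighbors_sum x y (cst 1) (fun=> ler01) xy.
rewrite /= mulr1; under eq_fsbigr do rewrite mulr1.
exact/lt_le_trans/mu_gt0.
Qed.

Lemma laplacian_gain_loss f x :
  laplacian G sigma f x + f x `^ q = gain f x - loss x * f x.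
Proof.
rewrite /laplacian /gain /loss /degree !neighbors_sumE.
under eq_bigr do rewrite mulrBr.
by rewrite sumrB -mulr_suml; ring.
Qed.

Lemma gain_ge0 f x : (forall y, 0 <= f y) -> 0 <= gain f x.
Proof.
move=> f0; rewrite addr_ge0 ?powR_ge0// mulr_ge0 ?invr_ge0 ?nu_ge0//.
by rewrite neighbors_sumE sumr_ge0// => y _; rewrite mulr_ge0// mu_ge0.
Qed.

Lemma le_gain f g x : (forall y, 0 <= f y <= g y) -> gain f x <= gain g x.
Proof.
move=> fg; have fx y : 0 <= f y by have /andP[] := fg y.
have {}fg y : f y <= g y by have /andP[] := fg y.
rewrite lerD ?ge0_ler_powR ?nnegrE ?(ltW q_gt0)//; last exact: le_trans (fg x).
by rewrite ler_wpM2l ?invr_ge0 ?nu_ge0// le_neighbors_sum.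
Qed.

(** This propagates zeros to neighbours: a vanishing sum of nonnegative terms
    has only zero terms. *)
Lemma gain_eq0 f x y :
  (forall z, 0 <= f z) -> gain f x = 0 -> adj G x y -> f y = 0.
Proof.
move=> f0 gx0 xy; have nu0 := adj_nu_gt0 xy.
have : (nu G sigma x)^-1 * (mu G x y * f y) <= 0.
  rewrite -gx0 (le_trans (ler_wpM2l _ (le_term_neighbors_sum f0 xy)))//.
    by rewrite invr_ge0 ltW.
  by rewrite lerDl powR_ge0.
rewrite pmulr_rle0 ?invr_gt0// pmulr_rle0 ?mu_gt0// => fy0.
by apply/eqP; rewrite eq_le fy0 f0.
Qed.

(** Local finiteness makes the gain continuous for pointwise convergence. It is
    used both along time and along the sequence of iterates. *)
Lemma cvg_gain (T : Type) (F : set_system T) (FF : Filter F)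
    (f : T -> V -> R) (l : V -> R) x :
  (forall z y, 0 <= f z y) -> (forall y, 0 <= l y) ->
  (forall y, f z y @[z --> F] --> l y) -> gain (f z) x @[z --> F] --> gain l x.
Proof.
move=> f0 l0 fl; apply: cvgD; last exact: cvg_powR.
apply: cvgM; first exact: cvg_cst.
rewrite neighbors_sumE; under eq_fun do rewrite neighbors_sumE.
apply: cvg_big => [|y _]; first exact: add_continuous.
by apply: cvgM; [exact: cvg_cst|exact: fl].
Qed.

(** Connectedness, as an induction principle. *)
Lemma connected_ind (P : V -> Prop) :
  (forall x y, adj G x y -> P x -> P y) -> forall x y, P x -> P y.
Proof.
move=> Padj x y; have [p + <-] := adj_connected G x y.
by elim: p x => //= z p IHp x /andP[xz zp] /(Padj _ _ xz); exact: IHp.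
Qed.

End GraphOperators.

(** * Monotone iteration below a supersolution *)

Section Construction.
Variables (R : realType) (V : choiceType) (G : weightedGraph R V).
Variables (sigma : V -> R) (q : R).
Hypotheses (sigma_gt0 : forall x, 0 < sigma x) (q_gt0 : 0 < q).

Local Notation loss := (loss G sigma).
Local Notation gain := (gain G sigma q).

Variable u0 : V -> R.
Hypothesis u0_ge0 : forall x, 0 <= u0 x.

(** The barrier W stands for the translate U(s + .), and dW for its time
    derivative. *)
Variables (W dW : R -> V -> R).
Hypothesis W_ge0 : forall (t : R) (x : V), 0 <= W t x.
Hypothesis continuous_W : forall x, continuous (W ^~ x).
Hypothesis is_derive_W : forall (t : R) (x : V), 0 < t ->
  is_derive t 1 (W ^~ x) (dW t x).
Hypothesis W_super :
  forall (t : R) (x : V), 0 < t -> gain (W t) x <= dW t x + loss x * W t x.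
Hypothesis u0_le_W : forall x, u0 x <= W 0 x.

Definition duhamel_map (v : R -> V -> R) t x : R :=
  duhamel (loss x) (u0 x) (fun r => gain (v r) x) t.

Definition picard n : R -> V -> R := iter n duhamel_map (fun _ _ => 0).

Lemma picardS n : picard n.+1 = duhamel_map (picard n). Proof. by []. Qed.

Lemma continuous_gain (v : R -> V -> R) x :
  (forall t y, 0 <= v t y) -> (forall y, continuous (v ^~ y)) ->
  continuous (fun t => gain (v t) x).
Proof.
by move=> v0 cv t; apply: cvg_gain => // y; exact: cv.
Qed.

(** Continuity and the two bounds go together: the comparison that bounds an
    iterate requires the source built from the previous one to be continuous. *)
Lemma picard_continuous_bounded n :
  (forall x, continuous (picard n ^~ x)) /\
  (forall (t : R) (x : V), 0 <= picard n t x <= W (clamp t) x).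
Proof.
elim: n => [|n [cn bn]].
  by split=> [x|t x] /=; [exact: cst_continuous|rewrite lexx W_ge0].
have n0 t x : 0 <= picard n t x by have /andP[] := bn t x.
have cg x : continuous (fun t => gain (picard n t) x) by exact: continuous_gain.
rewrite picardS; split=> [x|t x].
  exact/continuous_duhamel/continuous_duhamel_integrable.
apply/andP; split.
- apply: le_trans (duhamel_ge_initial _ _ (cg x) _ _).
    by rewrite mulr_ge0 ?expR_ge0.
  by move=> r _; exact: gain_ge0.
- apply: (duhamel_le_super (cg x) (@continuous_W x) (is_derive_W ^~ x)) => //.
  move=> r r0; apply: le_trans (W_super _ r0).
  apply: le_gain => // y; have := bn r y.
  by rewrite clamp_id// ltW.
Qed.

Lemma continuous_picard n x : continuous (picard n ^~ x).
Proof. by have [] := picard_continuous_bounded n. Qed.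

Lemma picard_ge0 n t x : 0 <= picard n t x.
Proof. by have [_ /(_ t x)/andP[]] := picard_continuous_bounded n. Qed.

Lemma picard_le n t x : picard n t x <= W (clamp t) x.
Proof. by have [_ /(_ t x)/andP[]] := picard_continuous_bounded n. Qed.

Lemma continuous_gain_picard n x : continuous (fun t => gain (picard n t) x).
Proof.
by apply: continuous_gain; [exact: picard_ge0|exact: continuous_picard].
Qed.

Lemma picard_leS n t x : picard n t x <= picard n.+1 t x.
Proof.
elim: n t x => [|n IHn] t x; first exact: picard_ge0.
rewrite (picardS n) (picardS n.+1).
apply: (@le_duhamel R (loss x) (u0 x) (fun r => gain (picard n r) x)
  (fun r => gain (picard n.+1 r) x)); try exact: continuous_gain_picard.
by move=> r _; apply: le_gain => // y; rewrite picard_ge0 IHn.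
Qed.

Definition picard_lim t x : R := limn (fun n => picard n t x).

Lemma picard_cvg t x : picard n t x @[n --> \oo] --> picard_lim t x.
Proof.
apply: nondecreasing_is_cvgn.
  by apply/nondecreasing_seqP => n; exact: picard_leS.
by exists (W (clamp t) x) => _ [n _ <-]; exact: picard_le.
Qed.

Lemma picard_lim_ge0 t x : 0 <= picard_lim t x.
Proof.
apply: limr_ge; first exact: picard_cvg.
by apply: nearW => n; exact: picard_ge0.
Qed.

Lemma picard_lim_le t x : picard_lim t x <= W (clamp t) x.
Proof.
apply: limr_le; first exact: picard_cvg.
by apply: nearW => n; exact: picard_le.
Qed.

(** Both sides are limits of the iterates: the right-hand side, by dominated
    convergence under the source of the barrier, is the limit of the sequence
    shifted by one. *)
Lemma picard_lim_duhamel x :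
  duhamel_integrable (loss x) (fun r => gain (picard_lim r) x) /\
  picard_lim ^~ x =
    duhamel (loss x) (u0 x) (fun r => gain (picard_lim r) x).
Proof.
have [||||ig cg] := @duhamel_cvg R (loss x) (u0 x)
  (fun n r => gain (picard n r) x) (fun r => gain (picard_lim r) x)
  (fun r => gain (W r) x).
- by move=> n; exact: continuous_gain_picard.
- exact: continuous_gain.
- move=> n r r0; rewrite gain_ge0//=; last by move=> y; exact: picard_ge0.
  apply: le_gain => // y; rewrite picard_ge0/=.
  by have := picard_le n r y; rewrite clamp_id.
- move=> r r0; apply: cvg_gain => //.
  + by move=> n y; exact: picard_ge0.
  + by move=> y; exact: picard_lim_ge0.
  + by move=> y; exact: picard_cvg.
split=> //; apply/funext => t.
apply: (@cvg_unique _ (@Rhausdorff R) ((fun n => picard n.+1 t x) @ \oo)).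
  by have := @picard_cvg t x; rewrite -cvg_shiftS.
exact: cg.
Qed.

Lemma continuous_picard_lim x : continuous (picard_lim ^~ x).
Proof.
by have [ig ->] := picard_lim_duhamel x; exact: continuous_duhamel.
Qed.

Lemma continuous_gain_picard_lim x :
  continuous (fun t => gain (picard_lim t) x).
Proof.
by apply: continuous_gain; [exact: picard_lim_ge0|exact: continuous_picard_lim].
Qed.

Lemma is_derive_picard_lim (t : R) (x : V) : 0 < t ->
  is_derive t 1 (picard_lim ^~ x)
    (gain (picard_lim t) x - loss x * picard_lim t x).
Proof.
move=> t0; have [ig uE] := picard_lim_duhamel x.
have -> : picard_lim t x =
    duhamel (loss x) (u0 x) (fun r => gain (picard_lim r) x) t.
  by rewrite -uE.
rewrite uE; apply: is_derive_duhamel => //; exact: continuous_gain_picard_lim.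
Qed.

Lemma picard_lim0 x : picard_lim 0 x = u0 x.
Proof.
have [_ /(congr1 (fun f => f 0)) ->] := picard_lim_duhamel x.
by rewrite duhamel0.
Qed.

(** A zero at a positive time is an interior minimum in time, so the time
    derivative and the loss both vanish there, and with them the gain. *)
Lemma picard_lim_eq0_adj t x y : 0 < t -> adj G x y ->
  picard_lim t x = 0 -> picard_lim t y = 0.
Proof.
move=> t0 xy ux0; apply: (@gain_eq0 R V G sigma q sigma_gt0 _ x y) => //.
  by move=> z; exact: picard_lim_ge0.
have t2 : 0 <= t + 1 by rewrite addr_ge0 ?ltW.
have [||||_ d0] := @derive1_at_min R (picard_lim ^~ x) 0 (t + 1) t => //.
- by move=> r; rewrite in_itv/= => /andP[/(is_derive_picard_lim x)[]].
- by rewrite in_itv/= t0 ltrDl ltr01.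
- by move=> r _; rewrite ux0 picard_lim_ge0.
have [_] := is_derive_picard_lim x t0.
by rewrite d0 ux0 mulr0 subr0.
Qed.

(** A zero at x would spread to o, where the solution is at least the free decay
    e^(-kt) u0(o). *)
Lemma picard_lim_gt0 t x o : 0 < u0 o -> 0 < t -> 0 < picard_lim t x.
Proof.
move=> u0o t0; rewrite lt_neqAle picard_lim_ge0 andbT eq_sym; apply/eqP => ux0.
have : picard_lim t o = 0.
  apply: (@connected_ind _ _ G (fun y => picard_lim t y = 0) _ _ _ ux0) => y z.
  exact: picard_lim_eq0_adj.
apply/eqP; rewrite gt_eqF//.
have [_ /(congr1 (fun f => f t)) ->] := picard_lim_duhamel o.
apply: lt_le_trans (duhamel_ge_initial _ _ (@continuous_gain_picard_lim o) _ _).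
  by rewrite mulr_gt0 ?expR_gt0.
by move=> r _; apply: gain_ge0 => // y; exact: picard_lim_ge0.
Qed.

Lemma picard_lim_cauchy o : 0 < u0 o ->
  positive_cauchy_solution G sigma q u0 picard_lim.
Proof.
move=> u0o; split.
- by move=> t x _; exact: picard_lim_ge0.
- move=> x; split; first exact/continuous_subspaceT/continuous_picard_lim.
  move=> t t0; have [du _] := is_derive_picard_lim x t0; split; first exact: du.
  pose d r := gain (picard_lim r) x - loss x * picard_lim r x.
  have dE r : 0 < r -> derive1 (picard_lim ^~ x) r = d r.
    by move=> r0; rewrite derive1E; have [] := is_derive_picard_lim x r0.
  have cd : continuous d.
    move=> r; apply: cvgB; first exact: continuous_gain_picard_lim.
    by apply: (@cvgM _ _ _ _ (cst (loss x)) (picard_lim ^~ x));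
      [exact: cvg_cst|exact: continuous_picard_lim].
  rewrite /prop_for /continuous_at dE//.
  apply: (@cvg_trans _ (d r @[r --> t])).
    by apply: near_eq_cvg; apply: filterS (lt_nbhsr t0) => r /dE.
  exact: cd.
- move=> t x t0; rewrite /dt derive1E.
  have [_ ->] := is_derive_picard_lim x t0.
  by have := laplacian_gain_loss G sigma q (picard_lim t) x; lra.
- exact: picard_lim0.
- by move=> t x; exact: picard_lim_gt0 u0o.
Qed.

End Construction.

(** * Solutions below a supersolution *)

(** Since s > 0, the translate U(s + t) is regular up to t = 0, so it is a
    barrier with an initial value although U itself may have none. *)
Lemma cauchy_solution_below_supersolution (R : realType) (V : choiceType)
    (G : weightedGraph R V) (sigma : V -> R) (q : R) (U : R -> V -> R)
    (s : R) (u0 : V -> R) (o : V) :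
  (forall x, 0 < sigma x) -> 0 < q -> nonneg_supersolution G sigma q U ->
  0 < s -> (forall x, 0 <= u0 x <= U s x) -> 0 < u0 o ->
  exists u, positive_cauchy_solution G sigma q u0 u /\
    forall (t : R) (x : V), 0 < t -> 0 < u t x <= U (s + t) x.
Proof.
move=> sigma_gt0 q_gt0 [U0 UC1 Usuper] s0 u0U u0o.
have sc t : 0 < s + clamp t by rewrite ltr_wpDr ?clamp_ge0.
pose W t x := U (s + clamp t) x.
pose dW t x := dt U (s + t) x.
have W_ge0 t x : 0 <= W t x by exact: U0.
have dU (t : R) (x : V) : 0 < t -> is_derive t 1 (U ^~ x) (dt U t x).
  move=> t0; rewrite /dt derive1E; apply: derivableP.
  exact: (proj1 (UC1 x _ t0)).
have continuous_W x : continuous (W ^~ x).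
  move=> t; apply: (@continuous_comp _ _ _ (fun r => s + clamp r) (U ^~ x)).
    by apply: cvgD; [exact: cvg_cst|exact: continuous_clamp].
  apply: differentiable_continuous; apply/derivable1_diffP.
  exact: (proj1 (UC1 x _ (sc t))).
have is_derive_W (t : R) (x : V) : 0 < t -> is_derive t 1 (W ^~ x) (dW t x).
  move=> t0; apply: (@near_eq_is_derive _ _ _ ((U ^~ x) \o (fun r => s + r))).
    by apply: filterS (near_clamp t0) => r rE; rewrite /W rE.
  have st0 : 0 < s + t by rewrite addr_gt0.
  have := dU _ x st0; rewrite -/(dW t x) => dUst.
  have ds : is_derive t 1 (fun r : R => s + r) 1.
    have -> : (fun r : R => s + r) = cst s + id by apply/funext.
    by apply: is_derive_eq; rewrite add0r.
  by apply: is_derive_eq; rewrite mulr1.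
have W_super (t : R) (x : V) : 0 < t ->
    gain G sigma q (W t) x <= dW t x + loss G sigma x * W t x.
  move=> t0; have st0 : 0 < s + t by rewrite addr_gt0.
  have := Usuper _ x st0.
  have := laplacian_gain_loss G sigma q (U (s + t)) x.
  have -> : W t = U (s + t) by apply/funext => y; rewrite /W clamp_id// ltW.
  by rewrite /dW; lra.
have u0_ge0 x : 0 <= u0 x by have /andP[] := u0U x.
have u0_le_W x : u0 x <= W 0 x.
  by rewrite /W clamp_id// addr0; have /andP[] := u0U x.
exists (picard_lim G sigma q u0); split.
  exact: (picard_lim_cauchy sigma_gt0 q_gt0 u0_ge0 W_ge0 continuous_W
    is_derive_W W_super u0_le_W u0o).
move=> t x t0; apply/andP; split.
  exact: (picard_lim_gt0 sigma_gt0 q_gt0 u0_ge0 W_ge0 continuous_W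
    is_derive_W W_super u0_le_W x u0o t0).
have := picard_lim_le sigma_gt0 q_gt0 u0_ge0 W_ge0 continuous_W
  is_derive_W W_super u0_le_W t x.
by rewrite /W clampK clamp_id// ltW.
Qed.

Theorem proposition2p1 (R : realType) (V : choiceType)
    (G : weightedGraph R V)
    (sigma : V -> R) (sigma_gt0 : forall x, 0 < sigma x)
    (rho : V -> V -> R) (rho_length : edge_length G rho)
    (rho_adapted : adapted G sigma rho)
    (rho_proper : proper_path_metric G rho)
    (q : R) (q_gt1 : 1 < q) :
  [<-> (exists U, nonneg_supersolution G sigma q U /\ nontrivial U);
       (exists u, positive_solution G sigma q u);
       (exists (o : V) (a : R), 0 < a /\
          exists u, positive_cauchy_solution G sigma q
                      (fun x => a * \1_[set o] x) u);
       (exists U, nonneg_supersolution G sigma q U /\ positive U)]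
  /\
  (forall U : R -> V -> R,
     nonneg_supersolution G sigma q U -> nontrivial U ->
   forall (s : R) (o : V) (a : R), 0 < s -> 0 < U s o -> 0 < a < U s o ->
   exists u,
     positive_cauchy_solution G sigma q (fun x => a * \1_[set o] x) u /\
     forall (t : R) (x : V), 0 < t -> 0 < u t x <= U (s + t) x).
Proof.
have q_gt0 : 0 < q by exact: lt_trans q_gt1.
have main U s o a : nonneg_supersolution G sigma q U -> 0 < s ->
    0 < a < U s o -> exists u,
     positive_cauchy_solution G sigma q (fun x => a * \1_[set o] x) u /\
     forall (t : R) (x : V), 0 < t -> 0 < u t x <= U (s + t) x.
  move=> supU s0 /andP[a0 aU].
  apply: (cauchy_solution_below_supersolution (o := o)) => //.
    move=> x; rewrite indicE; case: (boolP (x \in [set o])) => [/set_mem/=->|_].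
      by rewrite mulr1 (ltW a0) (ltW aU).
    by rewrite mulr0 lexx/=; case: supU => + _ _; apply.
  by rewrite indicE mem_set// mulr1.
have half (u : R) : 0 < u -> 0 < u / 2 < u by move=> u0; apply/andP; split; lra.
have [x0 _] : [set: V] !=set0.
  by apply/infinite_setN0; exact: vertices_infinite G.
split; last by move=> U supU _ s o a s0 _; exact: main.
tfae.
- move=> [U [supU [s [x [s0 Usx]]]]].
  have Usx0 : 0 < U s x.
    by rewrite lt_neqAle eq_sym Usx; case: supU => + _ _; apply.
  have [u [[_ uC ueq _ u_gt0] _]] := main _ _ _ _ supU s0 (half _ Usx0).
  by exists u; split=> // y; have [] := uC y.
- move=> [u [u_gt0 uC1 ueq]].
  have supu : nonneg_supersolution G sigma q u.
    by split=> // [t x t0|t x t0]; [exact/ltW/u_gt0|rewrite ueq].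
  have u10 := u_gt0 1 x0 ltr01.
  exists x0, (u 1 x0 / 2); have := half _ u10 => /[dup] /andP[? _] ha.
  by split=> //; have [v [? _]] := main _ _ _ _ supu ltr01 ha; exists v.
- move=> [y [a [_ [u [u_ge0 uC ueq _ u_gt0]]]]]; exists u; split=> //.
  split=> [t x t0|x|t x t0]; first exact/ltW/u_gt0.
    by have [] := uC x.
  by rewrite ueq.
- move=> [U [supU U_gt0]]; exists U; split=> //.
  by exists 1, x0; rewrite ltr01 gt_eqF// U_gt0.
Qed.
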